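(* Let $r$ and $m$ be positive integers. Let $\mathcal{H}$ be an ordered $r$-uniform hypergraph matching. Assume that for every $r$-pattern $P$, every $P$-clique contained in $\mathcal{H}$ has size at most $m$. Then \[|\mathcal{H}|\le C_r\cdot m^{2^r-1},\qquad\text{where } C_r=2^{r-1}(r-1)!.\]
   Context: An $r$-uniform hypergraph matching is a finite collection of pairwise disjoint sets (edges), each of size $r$; its vertex set is the union of the edges. An ordered $r$-uniform hypergraph matching is such a matching together with a total ordering of its vertex set. An $r$-pattern is a string in $\{\mathrm{A},\mathrm{B}\}^{2r}$ that starts with $\mathrm{A}$ and contains exactly $r$ letters $\mathrm{A}$ and $r$ letters $\mathrm{B}$. For two distinct edges $e,f$ of an ordered matching, the $r$-pattern formed by $e$ and $f$ is obtained by listing the $2r$ vertices of $e\cup f$ in increasing order and writing $\mathrm{A}$ for vertices of one edge and $\mathrm{B}$ for vertices of the other, where the labels are chosen so that the string starts with $\mathrm{A}$ (i.e. the edge containing the smallest vertex gets $\mathrm{A}$). For an $r$-pattern $P$, a $P$-clique in $\mathcal{H}$ is a subset $\mathcal{H}'\subseteq\mathcal{H}$ such that every pair of distinct edges of $\mathcal{H}'$ forms the pattern $P$; its size is $|\mathcal{H}'|$. *)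

(* Defs.v *)
From mathcomp Require Import all_boot all_order.

Set Implicit Arguments.
Unset Strict Implicit.
Unset Printing Implicit Defensive.

(* Strings in {A, B} are encoded as boolean sequences: A = true, B = false. *)
Definition is_pattern (r : nat) (P : seq bool) : bool :=
  [&& size P == 2 * r, ohead P == Some true,
      count_mem true P == r & count_mem false P == r].

Section OrderedMatching.
Context {d : Order.disp_t} {T : finOrderType d}.
Implicit Types (e f : {set T}) (H K : {set {set T}}).

(* The vertex set is the whole type T, and its total order is that of T. *)
Definition ordered_matching (r : nat) H : Prop :=
  [/\ trivIset H, cover H = [set: T] & forall e, e \in H -> #|e| = r].

(* The vertices of e are labelled A (true), the other ones B (false). *)
Definition word e f : seq bool :=
  [seq x \in e | x <- sort <=%O (enum (e :|: f))].

Definition pattern e f : seq bool :=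
  if ohead (word e f) == Some true then word e f else word f e.

Definition clique (P : seq bool) K : Prop :=
  {in K &, forall e f, e != f -> pattern e f = P}.

End OrderedMatching.

(* Main.v *)
(* The idea is to cut the edges into more and more blocks of consecutive
   vertices, the blocks of all edges being separated by common points of the
   ground order. Suppose that there are k blocks, and that refining by any one
   of the r - k remaining cuts leaves at most B edges. Let f meet e if the first
   vertex of a block of f lies in the span of the same block of e. Then f meets
   at most (r - k) B edges, itself included, since the edges met at a fixed
   position are separated there by that vertex of f. Hence some 1/(2 (r - k) B)
   of the edges are pairwise non-meeting. For those, the pattern of a pair is
   determined by the k relative orders of corresponding blocks, so that
   Erdos-Szekeres with 2^(k-1) colours leaves at most m^(2^(k-1)) of them.
   Multiplying over k = 1, ..., r gives 2^(r-1) (r-1)! m^(1+2+...+2^(r-1)). *)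
Require Import Defs.
From mathcomp Require Import all_boot all_order.
From mathcomp Require Import zify.

Set Implicit Arguments.
Unset Strict Implicit.
Unset Printing Implicit Defensive.

Import Order.TTheory.

(** * Independent sets in digraphs, and chains in several colours *)

Lemma independent_set (X : finType) (R : rel X) (D : nat) (K : {set X}) :
  {in K, reflexive R} ->
  {in K, forall x, #|[set y in K | R x y]| <= D} ->
  exists2 I : {set X}, I \subset K &
    {in I &, forall x y, x != y -> ~~ R x y} /\ #|K| <= 2 * D * #|I|.
Proof.
move: {2}#|K| (leqnn #|K|) => n; elim: n K => [|n IHn] K leKn reflR degR.
  exists set0; first exact: sub0set.
  by split=> [x y|]; rewrite ?inE // cards0 muln0.
have [->|[x0 Kx0]] := set_0Vmem K.
  exists set0; first exact: sub0set.
  by split=> [x y|]; rewrite ?inE // !cards0.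
(* Out- and in-neighbourhoods together have average size at most [2 * D]; pick a
   vertex where they are small, delete its neighbourhood and recurse. *)
pose out x := [set y in K | R x y]; pose inn x := [set y in K | R y x].
have sum_inn: \sum_(x in K) #|inn x| = \sum_(x in K) #|out x|.
  have cardE (P : rel X) : \sum_(x in K) #|[set y in K | P x y]|
      = \sum_(x in K) \sum_(y in K) P x y.
    apply: eq_bigr => x _; rewrite -sum1_card big_mkcond [RHS]big_mkcond.
    by apply: eq_bigr => y _; rewrite inE; case: (y \in K); case: (P x y).
  by rewrite (cardE (fun x y => R y x)) (cardE R) exchange_big.
have [x Kx degx]: exists2 x, x \in K & #|out x| + #|inn x| <= 2 * D.
  apply/exists_inP; apply: contraT => /exists_inPn noX.
  have lt_sum: \sum_(x in K) (2 * D).+1 <= \sum_(x in K) (#|out x| + #|inn x|).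
    by apply: leq_sum => x Kx; rewrite ltnNge noX.
  have le_out: \sum_(x in K) #|out x| <= \sum_(x in K) D.
    by apply: leq_sum => x Kx; apply: degR.
  move: lt_sum le_out; rewrite big_split /= sum_inn !sum_nat_const.
  have: 0 < #|K| by apply/card_gt0P; exists x0.
  nia.
pose N := out x :|: inn x.
(* Reflexivity puts [x] into the deleted set [N], so the recursion runs on a strictly smaller
   set. *)
have Nx : x \in N by rewrite !inE Kx reflR.
have cardN : #|N| <= 2 * D.
  by apply: leq_trans degx; rewrite cardsU leq_subr.
have sKN : K :\: N \subset K by apply: subsetDl.
have [|||I sIKN [indI cardI]] := IHn (K :\: N).
- have: K :\: N \proper K.
    by rewrite properEneq sKN andbT; apply/eqP => /setP/(_ x);
      rewrite inE Nx Kx.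
  by move/proper_card; lia.
- by move=> y /(subsetP sKN); apply: reflR.
- move=> y /(subsetP sKN) Ky; apply: leq_trans (degR y Ky).
  by apply/subset_leq_card/subsetP => z; rewrite !inE => /andP[/andP[_ ->]].
have IN y : y \in I -> [/\ y \in K, ~~ R x y & ~~ R y x].
  by move=> /(subsetP sIKN); rewrite !inE; case: (y \in K);
    rewrite ?andbF //= negb_or => /andP[/andP[]].
exists (x |: I).
  by rewrite subUset sub1set Kx (subset_trans sIKN).
split=> [y z|].
  rewrite !inE => /predU1P[->|Iy] /predU1P[->|Iz]; rewrite ?eqxx //.
  - by case: (IN z Iz).
  - by case: (IN y Iy).
  - exact: indI.
have xI : x \notin I by apply/negP => /IN[_]; rewrite reflR.
rewrite cardsU1 xI; have := cardsID N K;
  have := subset_leq_card (subsetIr K N); nia.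
Qed.

(** Two elements related in colour [c] have different longest-chain lengths in that colour, so the
    vector of these lengths over all colours is injective on [I]. *)
Lemma erdos_szekeres (X C : finType) (R : C -> rel X) (I : {set X}) (m : nat) :
  0 < m -> (forall c, irreflexive (R c)) -> (forall c, transitive (R c)) ->
  {in I &, forall x y, x != y -> exists c, R c x y || R c y x} ->
  (forall c (J : {set X}), J \subset I ->
     {in J &, forall x y, x != y -> R c x y || R c y x} -> #|J| <= m) ->
  #|I| <= m ^ #|C|.
Proof.
case: m => // m _ irrR transR totR chainR.
(* Label x by the lengths of the longest [R c]-chains with last element x. *)
pose comp c y z := (y != z) ==> (R c y z || R c z y).
pose chains c x : {set {set X}} := [set J : {set X} | [&& J \subset I, x \in J,
  [forall y in J, forall z in J, comp c y z] &
  [forall y in J, (y != x) ==> R c y x]]].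
have chainsP c x (J : {set X}) : reflect
    [/\ J \subset I, x \in J, {in J &, forall y z, comp c y z} &
        {in J, forall y, y != x -> R c y x}] (J \in chains c x).
  rewrite inE; apply: (iffP and4P) => -[sJI Jx chJ maxJ]; split=> //.
  - by move=> y z Jy Jz; have /forall_inP/(_ z Jz) := forall_inP chJ y Jy.
  - by move=> y Jy yx; apply: (implyP (forall_inP maxJ y Jy)).
  - by apply/forall_inP => y Jy; apply/forall_inP => z Jz; apply: chJ.
  - by apply/forall_inP => y Jy; apply/implyP => yx; apply: maxJ.
pose len c x := \max_(J in chains c x) #|J|.
have len_m c x : len c x <= m.+1.
  apply/bigmax_leqP => J /chainsP[sJI _ chJ _];
    apply: (chainR c) => // y z Jy Jz.
  exact/implyP/chJ.
have chain1 c x : x \in I -> [set x] \in chains c x.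
  move=> Ix; apply/chainsP; split=> [|||y /set1P->];
    rewrite ?set11 ?sub1set ?eqxx //.
  by move=> y z /set1P-> /set1P->; rewrite /comp eqxx.
have len_gt0 c x : x \in I -> 0 < len c x.
  by move=> Ix; rewrite -(cards1 x); apply: leq_bigmax_cond; apply: chain1.
have len_lt c x y : x \in I -> y \in I -> R c x y -> len c x < len c y.
  move=> Ix Iy Rxy.
  have [|J /chainsP[sJI Jx chJ maxJ] lenJ] :=
      @eq_bigmax_cond _ [in chains c x] (fun J : {set X} => #|J|).
    by apply/card_gt0P; exists [set x]; apply: chain1.
  have lt_y z : z \in J -> R c z y.
    move=> Jz; have [->//|zx] := eqVneq z x.
    exact: transR (maxJ z Jz zx) Rxy.
  have J'y : y \notin J by apply/negP => /lt_y; rewrite irrR.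
  have -> : len c x = #|J| by [].
  have <- : #|y |: J| = #|J|.+1 by rewrite cardsU1 J'y.
  apply: leq_bigmax_cond; apply/chainsP; split.
  - by rewrite subUset sub1set Iy.
  - by rewrite setU11.
  - move=> u v /setU1P[->|Ju] /setU1P[->|Jv]; apply/implyP; rewrite ?eqxx //.
    + by rewrite (lt_y v) // orbT.
    + by rewrite (lt_y u).
    + exact/implyP/chJ.
  - by move=> z /setU1P[->|/lt_y //]; rewrite eqxx.
(* Here [m] is the predecessor of the original bound. On [I] the lengths lie between 1 and [m.+1],
   and the shift by one makes them fit ['I_m.+1]. *)
pose label x := [ffun c => inord (len c x).-1 : 'I_m.+1].
have labelE c x : x \in I -> label x c = (len c x).-1 :> nat.
  by move=> Ix; rewrite ffunE inordK // prednK ?len_gt0.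
rewrite -[m.+1]card_ord -card_ffun -(@card_in_imset _ _ label I) ?max_card //.
move=> x y Ix Iy eq_label; apply/eqP; apply: contraT => /(totR x y Ix Iy)[c].
have: len c x = len c y.
  rewrite -[len c x]prednK ?len_gt0 // -[len c y]prednK ?len_gt0 //.
  by rewrite -!labelE // eq_label.
by move=> eq_len /orP[] /len_lt; rewrite eq_len ltnn => ->.
Qed.

(** * Blocks of positions determined by a set of cuts *)

Section Blocks.
Context {n : nat}.
Implicit Types (S : {set 'I_n}) (i j k : nat).

(* Positions in an edge are numbered from 0. [t \in S] encodes a cut between the
   positions [t] and [t.+1]; the cuts split the positions into blocks. *)
Definition starts_block S j := [exists t in S, t.+1 == j].

Fixpoint block_start S i :=
  if i is i'.+1 then if starts_block S i then i else block_start S i' else 0.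

Lemma starts_blockS S (t : 'I_n) : starts_block S t.+1 = (t \in S).
Proof.
apply/exists_inP/idP => [[u Su /eqP[/val_inj <-]] //|St].
by exists t.
Qed.

Lemma block_start_le S i : block_start S i <= i.
Proof. by elim: i => //= i IHi; case: ifP => // _; apply: leqW. Qed.

Lemma block_startP S i : 0 < block_start S i ->
  exists2 t : 'I_n, t \in S & block_start S i = t.+1.
Proof.
elim: i => //= i IHi; case: ifP => // /exists_inP[t St /eqP <-] _.
by exists t.
Qed.

Lemma leq_block_start S (t : 'I_n) i :
  t \in S -> t < i -> t < block_start S i.
Proof.
move=> St; elim: i => //= i IHi; rewrite ltnS leq_eqVlt => /predU1P[<-|lti].
  by rewrite starts_blockS St.
by case: ifP => // _; [rewrite ltnW | apply: IHi].
Qed.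

Lemma block_start_eq S i k :
  block_start S i <= k <= i -> block_start S k = block_start S i.
Proof.
case/andP=> leik leki; apply/eqP; rewrite eqn_leq; apply/andP; split.
  have [->//|] := posnP (block_start S k).
  case/block_startP=> t St eqt; rewrite eqt leq_block_start //.
  by apply: leq_trans leki; rewrite -eqt block_start_le.
have [->//|] := posnP (block_start S i).
by case/block_startP=> t St eqt; rewrite eqt leq_block_start // -eqt.
Qed.

End Blocks.

(** * Vertices by position, and the word of a pair of edges *)

Section Vertices.
Context {d : Order.disp_t} {T : finOrderType d} (x0 : T).
Implicit Types (e f : {set T}) (p : T).

Definition vertices e : seq T := sort <=%O (enum e).
Definition vertex e i := nth x0 (vertices e) i.
Definition rank e p := count (<= p)%O (vertices e).

Lemma size_vertices e : size (vertices e) = #|e|.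
Proof. by rewrite size_sort cardE. Qed.

Lemma mem_vertices e : vertices e =i e.
Proof. by move=> x; rewrite mem_sort mem_enum. Qed.

Lemma vertices_lt_sorted e : sorted <%O (vertices e).
Proof. by rewrite sort_lt_sorted enum_uniq. Qed.

Lemma vertex_in e i : i < #|e| -> vertex e i \in e.
Proof. by move=> lti; rewrite -mem_vertices mem_nth ?size_vertices. Qed.

Lemma lt_vertex e i j : i < #|e| -> j < #|e| ->
  (vertex e i < vertex e j)%O = (i < j).
Proof.
move=> lti ltj; apply: (lt_sorted_ltn_nth x0 (vertices_lt_sorted e));
by rewrite inE size_vertices.
Qed.

Lemma le_vertex e i j : i < #|e| -> j < #|e| ->
  (vertex e i <= vertex e j)%O = (i <= j).
Proof. by move=> lti ltj; rewrite leNgt lt_vertex // -leqNgt. Qed.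

(** An adjunction between positions and points, used to turn statements about ranks into comparisons
    of vertices. *)
Lemma ltn_rank e p i : i < #|e| -> (i < rank e p) = (vertex e i <= p)%O.
Proof.
move=> lti; apply/idP/idP => [lt|].
  by apply: nth_count_le lt; apply: sort_le_sorted.
apply: contraTT; rewrite -leqNgt -ltNge => le.
by apply: nth_count_gt; [apply: sort_le_sorted | rewrite size_vertices lti le].
Qed.

Lemma vertex_neq e f i j : [disjoint e & f] -> i < #|e| -> j < #|f| ->
  vertex e i != vertex f j.
Proof.
move=> ef lti ltj; apply: contraTneq (vertex_in lti) => ->.
by rewrite (disjointFl ef) ?vertex_in.
Qed.

(** The pairs are names for the vertices of [e] and [f] that do not depend on the edges, so that the
    words of different pairs can be compared through one list of names. *)
Definition slot e f (x : nat * bool) :=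
  if x.2 then vertex e x.1 else vertex f x.1.
Definition slots r : seq (nat * bool) :=
  [seq (i, true) | i <- iota 0 r] ++ [seq (i, false) | i <- iota 0 r].

Lemma mem_slots r x : (x \in slots r) = (x.1 < r).
Proof.
case: x => i b; rewrite mem_cat; apply/orP/idP => [[] /mapP[j]|/= ir].
- by rewrite mem_iota add0n => jr [-> _].
- by rewrite mem_iota add0n => jr [-> _].
by case: b; [left|right]; apply: map_f; rewrite mem_iota.
Qed.

Lemma perm_slots e f r : #|e| = r -> #|f| = r -> [disjoint e & f] ->
  perm_eq (enum (e :|: f)) (map (slot e f) (slots r)).
Proof.
move=> er fr ef.
have -> : map (slot e f) (slots r) = vertices e ++ vertices f.
  rewrite map_cat -!map_comp; congr (_ ++ _).
    by rewrite -[RHS](mkseq_nth x0) size_vertices er.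
  by rewrite -[RHS](mkseq_nth x0) size_vertices fr.
apply: uniq_perm; first exact: enum_uniq.
  rewrite cat_uniq !sort_uniq !enum_uniq andbT /=; apply/hasPn => x.
  by rewrite !mem_vertices => fx; rewrite (disjointFl ef).
by move=> x; rewrite mem_cat !mem_vertices mem_enum inE.
Qed.

Lemma word_slots e f r s : #|e| = r -> #|f| = r -> [disjoint e & f] ->
  perm_eq s (slots r) -> sorted <=%O (map (slot e f) s) ->
  word e f = [seq x.2 | x <- s].
Proof.
move=> er fr ef ps ss; rewrite /word.
have -> : sort <=%O (enum (e :|: f)) = map (slot e f) s.
  apply: le_sorted_eq => //; first exact: sort_le_sorted.
  by rewrite perm_sort (perm_trans (perm_slots er fr ef)) // perm_sym perm_map.
rewrite -map_comp; apply/eq_in_map => -[i b].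
rewrite (perm_mem ps) mem_slots /slot /= => ir.
by case: b; [rewrite vertex_in ?er | rewrite (disjointFl ef) ?vertex_in ?fr].
Qed.

Lemma perm_word e f r : #|e| = r -> #|f| = r -> [disjoint e & f] ->
  perm_eq (word e f) [seq x.2 | x <- slots r].
Proof.
move=> er fr ef; pose s := sort (relpre (slot e f) <=%O) (slots r).
rewrite (word_slots er fr ef (s := s)) ?perm_sort //.
  by rewrite perm_map // perm_sort.
by rewrite -sort_map sort_le_sorted.
Qed.

(** An ordering of the slots that sorts the first pair also sorts the second: comparisons inside an
    edge depend on positions only, and those across edges agree by hypothesis. *)
Lemma word_ext e f e' f' r :
  #|e| = r -> #|f| = r -> [disjoint e & f] ->
  #|e'| = r -> #|f'| = r -> [disjoint e' & f'] ->
  (forall i j, i < r -> j < r ->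
     (vertex e i < vertex f j)%O = (vertex e' i < vertex f' j)%O) ->
  word e f = word e' f'.
Proof.
move=> er fr ef er' fr' ef' eqlt.
pose s := sort (relpre (slot e f) <=%O) (slots r).
have ps : perm_eq s (slots r) by rewrite perm_sort.
have ss : sorted <=%O (map (slot e f) s) by rewrite -sort_map sort_le_sorted.
rewrite (word_slots er fr ef ps ss) (word_slots er' fr' ef' ps) //.
move: ss; rewrite !sorted_map; apply: (@sub_in_sorted _ [pred x | x.1 < r]);
  last first.
  by apply/allP => x; rewrite (perm_mem ps) mem_slots.
case=> i b [j c]; rewrite !inE /= => ir jr; rewrite /slot /=.
case: b; case: c; rewrite ?le_vertex ?er ?fr ?er' ?fr' //.
  by rewrite !le_eqVlt !(negPf (vertex_neq _ _ _)) ?er ?fr ?er' ?fr' //= eqlt.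
by rewrite !leNgt eqlt.
Qed.

Lemma word_negb e f : [disjoint e & f] -> word e f = map negb (word f e).
Proof.
move=> ef; rewrite /word setUC -map_comp; apply/eq_in_map => x.
rewrite mem_sort mem_enum inE /=.
case: (boolP (x \in e)) => [ex _|_]; first by rewrite (disjointFr ef).
by rewrite orbF => ->.
Qed.

Lemma ohead_word e f : 0 < #|e| -> 0 < #|f| -> (vertex e 0 < vertex f 0)%O ->
  ohead (word e f) = Some true.
Proof.
move=> e0 f0 ltef; rewrite /word.
have ss := sort_le_sorted (enum (e :|: f)).
have ms : sort <=%O (enum (e :|: f)) =i e :|: f.
  by move=> x; rewrite mem_sort mem_enum.
case: (sort _ _) ss ms => [_ /(_ (vertex e 0))|x s ss ms].
  by rewrite inE vertex_in.
have lex y : y \in e :|: f -> (x <= y)%O.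
  rewrite -ms => /predU1P[->//|sy]; move: ss.
  by rewrite /= le_path_sortedE => /andP[/allP/(_ y sy)].
congr Some; apply: contraTT ltef => e'x; rewrite -leNgt.
have fx : x \in f by move: (ms x); rewrite mem_head inE (negPf e'x).
have: (vertex f 0 <= x)%O.
  rewrite -(nth_index x0 (_ : x \in vertices f)) ?mem_vertices //.
  rewrite le_vertex // -size_vertices index_mem mem_vertices //.
by move=> /le_trans; apply; rewrite lex // inE vertex_in.
Qed.

Lemma is_pattern_word e f r : 0 < r -> #|e| = r -> #|f| = r ->
  [disjoint e & f] -> (vertex e 0 < vertex f 0)%O -> is_pattern r (word e f).
Proof.
move=> r0 er fr ef ltef; have pw := perm_word er fr ef.
have cst b : [seq x.2 | x <- [seq (i, b) | i <- iota 0 r]] = nseq r b.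
  by rewrite -map_comp -[r in RHS](size_iota 0); elim: (iota 0 r) => //= i s ->.
rewrite map_cat !cst in pw.
apply/and4P; split.
- by rewrite (perm_size pw) size_cat !size_nseq mul2n addnn.
- by rewrite ohead_word ?er ?fr.
- by rewrite (permP pw) count_cat !count_nseq /= mul1n addn0.
- by rewrite (permP pw) count_cat !count_nseq /= mul1n.
Qed.
End Vertices.

(** * Common cuts, non-meeting edges, and the induction on the number of missing cuts *)

Section Cuts.
Context {d : Order.disp_t} {T : finOrderType d} (x0 : T) {n : nat}.
Implicit Types (e f : {set T}) (K : {set {set T}}) (S : {set 'I_n}).
Local Notation vertex := (vertex x0).

(* A point with [t.+1] vertices of [e] weakly below it separates the positions
   [t] and [t.+1] of [e]; it has to be the same point for all edges of [K]. *)
Definition is_cut S K :=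
  forall t : 'I_n, t \in S -> exists p : T, {in K, forall e, rank e p = t.+1}.

(* The first vertex of some block of [f] lies in the span of the same block
   of [e], just after the vertex of [e] at position [t]. *)
Definition meets S f e :=
  [exists t in ~: S, rank e (vertex f (block_start S t)) == t.+1].

(** Take the smallest missing cut [t]. All earlier cuts are present, so [t] starts its own block,
    and the vertex of [e] there has rank [t.+1] in [e]. *)
Lemma meets_refl S e : #|e| = n.+1 -> S != [set: 'I_n] -> meets S e e.
Proof.
move=> en; rewrite -subTset => /subsetPn[t0 _ S't0].
case: (@arg_minnP _ t0 [pred t : 'I_n | t \notin S] val S't0) => t /= S't mint.
apply/exists_inP; exists t; first by rewrite inE.
have -> : block_start S t = t.
  case: t S't mint => -[|i] lti //= S't mint.
  suff -> : starts_block S i.+1 by [].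
  have lti' : i < n by apply: ltnW.
  rewrite (starts_blockS S (Ordinal lti')).
  by apply: contraT => /mint /=; rewrite ltnn.
have lt1 : t < #|e| by rewrite en ltnS ltnW.
have lt2 : t.+1 < #|e| by rewrite en ltnS.
by apply/eqP/anti_leq; rewrite (ltn_rank x0) // lexx leqNgt (ltn_rank x0) //
  le_vertex // ltnn.
Qed.

(** Walk along the block of [e]: if its vertex at [k] is below the first vertex of the block of [f],
    then so is the one at [k.+1], since otherwise that first vertex would have rank [k.+1] in [e]
    and [f] would meet [e]. *)
Lemma same_block_lt S e f i j :
  #|e| = n.+1 -> #|f| = n.+1 -> [disjoint e & f] -> ~~ meets S f e ->
  i <= n -> j <= n -> block_start S i = block_start S j ->
  (vertex e (block_start S i) < vertex f (block_start S i))%O ->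
  (vertex e i < vertex f j)%O.
Proof.
move=> en fn ef /exists_inPn apart lein lejn eqs lt0.
set s := block_start S i in eqs lt0.
have le_s k : s <= k -> k <= i -> (vertex e k <= vertex f s)%O.
  elim: k => [|k IHk]; first by rewrite leqn0 => /eqP s0 _; rewrite -s0 ltW.
  rewrite leq_eqVlt => /predU1P[<- _|]; first exact: ltW.
  rewrite ltnS => lesk ltki; have ltkn : k < n by apply: leq_trans lein.
  have S'k : Ordinal ltkn \notin S.
    apply/negP => /leq_block_start/(_ ltki) /=.
    by rewrite -/s ltnNge lesk.
  have := apart (Ordinal ltkn); rewrite inE S'k => /(_ isT) /=.
  rewrite (@block_start_eq _ S i) -/s ?lesk 1?ltnW //.
  rewrite -(ltn_rank x0) ?en ?ltnS // ltn_neqAle eq_sym => -> /=.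
  by rewrite (ltn_rank x0) ?en ?IHk // 1?ltnW // ltnS ltnW.
rewrite lt_neqAle vertex_neq ?en ?fn ?ltnS //=.
apply: le_trans (le_s i _ _) _ => //; first exact: block_start_le.
rewrite le_vertex ?fn ?ltnS // ?eqs ?block_start_le //.
by apply: leq_trans lejn; apply: block_start_le.
Qed.

(** The common point [p] of the cut that opens the block of [j] separates the two vertices. *)
Lemma distinct_block_lt S K e f i j :
  is_cut S K -> e \in K -> f \in K -> #|e| = n.+1 -> #|f| = n.+1 ->
  i <= n -> j <= n -> block_start S i < block_start S j ->
  (vertex e i < vertex f j)%O.
Proof.
move=> cutK Ke Kf en fn lein lejn ltij.
have [|t St eqt] := @block_startP _ S j; first exact: leq_trans ltij.
have [p rkp] := cutK t St.
have ltjn : t.+1 <= j by rewrite -eqt block_start_le.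
have leit : i <= t.
  by rewrite leqNgt; apply: contraL ltij => /(leq_block_start St);
    rewrite eqt -leqNgt.
have lep : (vertex e i <= p)%O by rewrite -(ltn_rank x0) ?en ?rkp.
apply: le_lt_trans lep _; rewrite ltNge -(ltn_rank x0) ?fn // rkp //.
by rewrite ltnS -ltnNge.
Qed.

(* For block-wise disjoint edges, the relative order of the first vertices of
   corresponding blocks determines the pattern. *)
Definition signed S (c : {ffun {t : 'I_n | t \in S} -> bool}) e f :=
  (vertex e 0 < vertex f 0)%O &&
  [forall t : {t | t \in S},
    (vertex e (val t).+1 < vertex f (val t).+1)%O == c t].

Lemma signed_irr S (c : {ffun {t : 'I_n | t \in S} -> bool}) :
  irreflexive (signed c).
Proof. by move=> e; rewrite /signed ltxx. Qed.

Lemma signed_trans S (c : {ffun {t : 'I_n | t \in S} -> bool}) :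
  transitive (signed c).
Proof.
move=> f e g /andP[lt_ef /forallP sef] /andP[lt_fg /forallP sfg].
rewrite /signed (lt_trans lt_ef lt_fg); apply/forallP => t.
move: (sef t) (sfg t) => /eqP + /eqP; case: (c t) => lt1 lt2.
  by rewrite (lt_trans lt1 lt2).
(* For a negative sign, the negated strict comparisons are reversed weak ones, which compose as
   well. *)
apply/eqP/negbTE; rewrite -leNgt; move/negbT: lt1; move/negbT: lt2.
by rewrite -!leNgt; apply: le_trans.
Qed.

(** By [word_ext] only comparisons across edges matter. In distinct blocks the cuts decide them; in
    the same block the first vertices do, and their order is recorded by [c]. *)
Lemma signed_word S K c e f e' f' :
  is_cut S K -> {in K, forall e, #|e| = n.+1} ->
  {in K &, forall e f, e != f -> [disjoint e & f]} ->
  {in K &, forall e f, e != f -> ~~ meets S e f} ->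
  e \in K -> f \in K -> e' \in K -> f' \in K ->
  @signed S c e f -> @signed S c e' f' -> word e f = word e' f'.
Proof.
move=> cutK cardK disjK apartK Ke Kf Ke' Kf' sgn sgn'.
have neq u v : signed c u v -> u != v.
  by apply: contraTneq => ->; rewrite signed_irr.
have ef := neq _ _ sgn; have ef' := neq _ _ sgn'.
(* The relation [meets] is not symmetric, so [apartK] is needed in both directions, one for each
   order of the first vertices. *)
have block_lt u v i j : u \in K -> v \in K -> u != v -> i < n.+1 -> j < n.+1 ->
    block_start S i = block_start S j -> (vertex u i < vertex v j)%O =
    (vertex u (block_start S i) < vertex v (block_start S i))%O.
  move=> Ku Kv uv lti ltj eqij; have vu : v != u by rewrite eq_sym.
  set s := block_start S i in eqij *.
  case: (ltP (vertex u s) (vertex v s)) => [lt_uv|].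
    by rewrite (same_block_lt (S := S)) ?disjK ?apartK ?cardK.
  have lts : s < n.+1 by apply: leq_ltn_trans lti; apply: block_start_le.
  rewrite le_eqVlt (negPf (vertex_neq _ _ _ _)) ?disjK ?cardK //= eqij => lt_vu.
  by apply/negbTE; rewrite -leNgt ltW //
    (same_block_lt (S := S)) ?disjK ?apartK ?cardK.
apply: (@word_ext _ _ x0 _ _ _ _ n.+1); rewrite ?cardK ?disjK // => i j lti ltj.
case: (ltngtP (block_start S i) (block_start S j)) => [ltij|ltji|eqij].
- by rewrite !(distinct_block_lt cutK) ?cardK.
- by rewrite !ltNge !ltW // (distinct_block_lt cutK) ?cardK.
rewrite (block_lt e f i j) // (block_lt e' f' i j) //;
  case/andP: sgn sgn' => lt0 /forallP sgn /andP[lt0' /forallP sgn'].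
have [->|] := posnP (block_start S i); first by rewrite lt0.
case/block_startP=> t St ->.
by move: (sgn (exist _ t St)) (sgn' (exist _ t St)) => /eqP-> /eqP->.
Qed.

Lemma clique_signed S K c e f (J : {set {set T}}) :
  is_cut S K -> {in K, forall e, #|e| = n.+1} ->
  {in K &, forall e f, e != f -> [disjoint e & f]} ->
  {in K &, forall e f, e != f -> ~~ meets S e f} ->
  J \subset K -> {in J &, forall e f, e != f -> signed c e f || signed c f e} ->
  e \in J -> f \in J -> @signed S c e f -> clique (word e f) J.
Proof.
move=> cutK cardK disjK apartK /subsetP sJK chJ Je Jf sgn u v Ju Jv uv.
have wordE a b : a \in J -> b \in J -> signed c a b -> word a b = word e f.
  by move=> Ja Jb sab; apply: (signed_word cutK cardK disjK apartK) sab sgn;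
    apply: sJK.
have head_word a b : a \in J -> b \in J -> signed c a b ->
    ohead (word a b) = Some true.
  by move=> Ja Jb /andP[lt0 _]; apply: ohead_word lt0; rewrite cardK ?sJK.
rewrite /pattern; case/orP: (chJ u v Ju Jv uv) => suv.
  by rewrite (head_word u v) ?eqxx ?wordE.
(* Here [v] has the smaller first vertex, so [word u v] starts with B and [pattern] selects
   [word v u]. *)
rewrite word_negb ?disjK ?sJK //; have := head_word v u Jv Ju suv.
by rewrite wordE //; case: (word e f) => //= _ w [->].
Qed.

(** The order of the very first vertices only orients a pair, so just one sign per cut remains and
    there are [2 ^ #|S|] colours. *)
Lemma card_apart S K m : 0 < m ->
  is_cut S K -> {in K, forall e, #|e| = n.+1} ->
  {in K &, forall e f, e != f -> [disjoint e & f]} ->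
  {in K &, forall e f, e != f -> ~~ meets S e f} ->
  (forall P, is_pattern n.+1 P ->
     forall J : {set {set T}}, J \subset K -> clique P J -> #|J| <= m) ->
  #|K| <= m ^ (2 ^ #|S|).
Proof.
move=> m0 cutK cardK disjK apartK cliqueK.
have -> : 2 ^ #|S| = #|{ffun {t : 'I_n | t \in S} -> bool}|.
  by rewrite card_ffun card_bool card_sig.
apply: (@erdos_szekeres _ _ (@signed S)) => //.
- exact: signed_irr.
- exact: signed_trans.
- move=> e f Ke Kf ef.
  have [lt0|lt0|/eqP] := ltgtP (vertex e 0) (vertex f 0); last first.
  + by rewrite (negPf (vertex_neq _ _ _ _)) ?disjK ?cardK.
  + exists [ffun t : {t | t \in S} =>
    (vertex f (val t).+1 < vertex e (val t).+1)%O].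
    by apply/orP; right; rewrite /signed lt0; apply/forallP => t; rewrite ffunE.
  exists [ffun t : {t | t \in S} =>
    (vertex e (val t).+1 < vertex f (val t).+1)%O].
  by apply/orP; left; rewrite /signed lt0; apply/forallP => t; rewrite ffunE.
(* Without two edges there is no pattern to read off, and positivity of [m] suffices. *)
move=> c J sJK chJ; have [J1|/card_gt1P[e [f [Je Jf ef]]]] := leqP #|J| 1.
  exact: leq_trans J1 m0.
have {e f Je Jf ef} [e [f [Je Jf sgn]]] :
    exists e f, [/\ e \in J, f \in J & signed c e f].
  by case/orP: (chJ e f Je Jf ef) => sgn; [exists e, f | exists f, e].
apply: (cliqueK (word e f)) => //; last first.
  exact: (clique_signed cutK cardK disjK apartK sJK chJ Je Jf sgn).
case/andP: (sgn) => lt0 _; have sJ := subsetP sJK.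
apply: (is_pattern_word _ _ _ _ lt0); rewrite ?cardK ?disjK ?sJ //.
by apply: contraTneq sgn => ->; rewrite signed_irr.
Qed.

(* The bound solves B(0) = m^(2^n), B(j+1) = 2 (j+1) B(j) m^(2^(n-j-1)). *)
Lemma card_cut S K m : 0 < m ->
  is_cut S K -> {in K, forall e, #|e| = n.+1} ->
  {in K &, forall e f, e != f -> [disjoint e & f]} ->
  (forall P, is_pattern n.+1 P ->
     forall J : {set {set T}}, J \subset K -> clique P J -> #|J| <= m) ->
  #|K| <= 2 ^ #|~: S| * #|~: S|`! * m ^ (2 ^ n.+1 - 2 ^ #|S|).
Proof.
move=> m0; move: {2}#|~: S| (erefl #|~: S|) => j.
elim: j S K => [|j IHj] S K cardS' cutK cardK disjK cliqueK.
  (* With every cut present no edges can meet, and the exponent 2^(n+1) - 2^n is 2^n. *)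
  have cardS : #|S| = n by have := cardsC S; rewrite cardS' card_ord addn0.
  rewrite cardS' cardS mul1n expnS mul2n -addnn addnK -cardS.
  apply: card_apart => // e f Ke Kf _; apply/exists_inPn => t.
  by move/eqP: cardS'; rewrite cards_eq0 => /eqP->; rewrite inE.
have cardS : #|S| + j.+1 = n by rewrite -cardS' cardsC card_ord.
set B := 2 ^ j * j`! * m ^ (2 ^ n.+1 - 2 ^ #|S|.+1).
(* The edges met by [f] at a given position [t] share the additional cut [t]. *)
have degK f : f \in K -> #|[set e in K | meets S f e]| <= j.+1 * B.
  move=> Kf; pose N t :=
    [set e in K | rank e (vertex f (block_start S t)) == t.+1].
  have sub : [set e in K | meets S f e] \subset \bigcup_(t in ~: S) N t.
    apply/subsetP => e; rewrite inE => /andP[Ke /exists_inP[t S't rkt]].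
    by apply/bigcupP; exists t => //; rewrite inE Ke.
  apply: leq_trans (subset_leq_card sub) _; rewrite -cardS' -sum_nat_const.
  apply: (big_ind2 (fun (A : {set {set T}}) k => #|A| <= k)) =>
    [|A k C l leA leC|t].
  - by rewrite cards0.
  - by rewrite cardsU (leq_trans (leq_subr _ _)) // leq_add.
  rewrite inE => S't.
  have sNK : N t \subset K by apply/subsetP => e; rewrite inE => /andP[].
  have cardtS : #|t |: S| = #|S|.+1 by rewrite cardsU1 S't.
  have cardtS' : #|~: (t |: S)| = j.
    by have := cardsC (t |: S); rewrite cardtS card_ord -[RHS]cardS; lia.
  have := IHj (t |: S) (N t) cardtS'; rewrite cardtS' cardtS; apply.
  - move=> u /setU1P[->|Su].
      by exists (vertex f (block_start S t)) => e; rewrite inE => /andP[_ /eqP].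
    have [p rkp] := cutK u Su; exists p => e /(subsetP sNK); exact: rkp.
  - by move=> e /(subsetP sNK); apply: cardK.
  - by move=> e g /(subsetP sNK) Ke /(subsetP sNK) Kg; apply: disjK.
  - by move=> P patP J sJN; apply: cliqueK (subset_trans sJN sNK).
have [||I sIK [apartI leKI]] :=
  independent_set (R := meets S) (D := j.+1 * B) (K := K).
- move=> e Ke; apply: meets_refl; first exact: cardK.
  by apply: contra_eq_neq cardS' => ->; rewrite setCT cards0.
- exact: degK.
have sI := subsetP sIK.
have leI : #|I| <= m ^ (2 ^ #|S|).
  apply: card_apart => //.
  - by move=> t St; have [p rkp] := cutK t St; exists p => e /sI; apply: rkp.
  - by move=> e /sI; apply: cardK.
  - by move=> e g /sI Ke /sI Kg; apply: disjK.
  - by move=> P patP J sJI; apply: cliqueK (subset_trans sJI sIK).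
apply: leq_trans leKI _; apply: leq_trans (leq_mul (leqnn _) leI) _.
(* The Erdos-Szekeres factor supplies the extra exponent [2 ^ #|S|], while the factor 2 (j+1) turns
   2^j j! into 2^(j+1) (j+1)!. *)
have expE : 2 ^ n.+1 - 2 ^ #|S| = (2 ^ n.+1 - 2 ^ #|S|.+1) + 2 ^ #|S|.
  have : 2 ^ #|S|.+1 <= 2 ^ n.+1 by rewrite leq_exp2l //; move: cardS; lia.
  by rewrite expnS; lia.
by rewrite cardS' expE expnD expnS factS /B; apply/eq_leq; nia.
Qed.
End Cuts.

Theorem theorem1p1 (r m : nat) (d : Order.disp_t) (T : finOrderType d)
    (H : {set {set T}}) :
  0 < r -> 0 < m ->
  ordered_matching r H ->
  (forall P : seq bool, is_pattern r P ->
     forall K : {set {set T}}, K \subset H -> clique P K -> #|K| <= m) ->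
  #|H| <= 2 ^ (r - 1) * (r - 1)`! * m ^ (2 ^ r - 1).
Proof.
case: r => // n _ m0 [trivH _ cardH] cliqueH; rewrite subn1 /=.
(* The default vertex [x0] comes from an edge, so the empty matching is treated apart. *)
have [->|[e He]] := set_0Vmem H; first by rewrite cards0.
have /card_gt0P[x0 _] : 0 < #|e| by rewrite cardH.
(* Start without cuts: each edge is a single block, and the exponent is 2^(n+1) - 2^0. *)
have := @card_cut _ _ x0 n set0 H m m0.
rewrite setC0 cardsT card_ord cards0; apply=> //; first by move=> t /[!inE].
by move=> f g Hf Hg; apply: (trivIsetP trivH).
Qed.
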